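(* Let $k$ be an algebraically closed field of characteristic zero, let $G$ be a finite group and let $\phi$ be a class-preserving automorphism of $G$. Then there is an invertible element $c\in k[G]$ such that $\phi(g)=cgc^{-1}$ for every $g\in G$ and such that $F=\Delta(c)^{-1}(c\otimes c)$ is a $G$-invariant element of $k[G]^{\otimes 2}$.
   Context: An automorphism $\phi$ of a finite group $G$ is class-preserving if $\phi(g)$ is conjugate to $g$ in $G$ for every $g\in G$. $\Delta:k[G]\to k[G]\otimes k[G]$ is the algebra homomorphism (coproduct of the group algebra) with $\Delta(g)=g\otimes g$ for $g\in G$. An element $F\in k[G]^{\otimes 2}$ is $G$-invariant if it commutes with $\Delta(g)=g\otimes g$ for all $g\in G$. *)

(* Defs.v *)
From HB Require Import structures.
From mathcomp Require Import all_boot all_algebra all_fingroup all_field.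

Set Implicit Arguments.
Unset Strict Implicit.
Unset Printing Implicit Defensive.

Import GRing.Theory.
Local Open Scope ring_scope.

(* The group algebra k[G], G being the whole finGroupType gT: functions on G
   under convolution. An alias is needed because {ffun gT -> k} already carries
   the pointwise product; k^o gives the k-linear structure. *)
Definition group_algebra (k : fieldType) (gT : finGroupType) : Type :=
  {ffun gT -> k^o}.

Section GroupAlgebra.

Variables (k : fieldType) (gT : finGroupType).
Local Notation kG := (group_algebra k gT).
Implicit Types (a b c : kG) (x y z : gT).

HB.instance Definition _ := Vector.copy kG {ffun gT -> k^o}.

Definition galg_elt x : kG := [ffun y => (y == x)%:R].

Definition galg_mul a b : kG := [ffun x => \sum_y a y * b (y^-1 * x)%g].

Fact galg_mulA : associative galg_mul.
Proof.
move=> a b c; apply/ffunP=> x; rewrite !ffunE.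
under eq_bigr do rewrite ffunE mulr_sumr.
under [RHS]eq_bigr do rewrite ffunE mulr_suml.
rewrite [RHS]exchange_big; apply: eq_bigr => y _ /=.
rewrite [RHS](reindex_inj (mulgI y)); apply: eq_bigr => z _ /=.
by rewrite mulrA mulKg invMg mulgA.
Qed.

Fact galg_mul1 : left_id (galg_elt 1%g) galg_mul.
Proof.
move=> a; apply/ffunP=> x; rewrite ffunE (bigD1 1%g) //= ffunE eqxx mul1r.
rewrite invg1 mul1g big1 ?addr0 // => y /negbTE ny.
by rewrite ffunE ny mul0r.
Qed.

Fact galg_mulr1 : right_id (galg_elt 1%g) galg_mul.
Proof.
move=> a; apply/ffunP=> x; rewrite ffunE (bigD1 x) //= ffunE mulVg eqxx mulr1.
rewrite big1 ?addr0 // => y /negbTE ny.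
by rewrite ffunE -(inj_eq (mulgI y)) mulKVg mulg1 eq_sym ny mulr0.
Qed.

Fact galg_mulDl : left_distributive galg_mul +%R.
Proof.
move=> a b c; apply/ffunP=> x; rewrite !ffunE -big_split /=.
by apply: eq_bigr => y _; rewrite ffunE mulrDl.
Qed.

Fact galg_mulDr : right_distributive galg_mul +%R.
Proof.
move=> a b c; apply/ffunP=> x; rewrite !ffunE -big_split /=.
by apply: eq_bigr => y _; rewrite ffunE mulrDr.
Qed.

Fact galg_1neq0 : galg_elt 1%g != 0.
Proof. by apply/eqP=> /ffunP/(_ 1%g)/eqP; rewrite !ffunE eqxx oner_eq0. Qed.

HB.instance Definition _ := GRing.Zmodule_isNzRing.Build kG
  galg_mulA galg_mul1 galg_mulr1 galg_mulDl galg_mulDr galg_1neq0.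

Fact galg_scaleAl (t : k) a b : t *: (a * b) = (t *: a) * b.
Proof.
apply/ffunP=> x; rewrite !ffunE scaler_sumr; apply: eq_bigr => y _.
by rewrite ffunE scalerAl.
Qed.

HB.instance Definition _ := GRing.Lmodule_isLalgebra.Build k kG galg_scaleAl.

Fact galg_scaleAr (t : k) a b : t *: (a * b) = a * (t *: b).
Proof.
apply/ffunP=> x; rewrite !ffunE scaler_sumr; apply: eq_bigr => y _.
by rewrite ffunE [RHS]mulrCA.
Qed.

HB.instance Definition _ := GRing.Lalgebra_isAlgebra.Build k kG galg_scaleAr.

HB.instance Definition _ := Algebra_isFalgebra.Build k kG.

Lemma galgE a : a = \sum_x a x *: galg_elt x.
Proof.
apply/ffunP=> x; rewrite sum_ffunE (bigD1 x) //= !ffunE eqxx big1.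
  by rewrite addr0 [RHS]mulr1.
by move=> y /negbTE ny; rewrite !ffunE eq_sym ny [LHS]mulr0.
Qed.

Lemma galg_linearE (V : lmodType k) (h : kG -> V) :
  linear h -> forall a, h a = \sum_x a x *: h (galg_elt x).
Proof.
move=> h_lin a; pose hM := GRing.isLinear.Build _ _ _ _ h h_lin.
pose h' : {linear kG -> V} := HB.pack h hM.
rewrite [in LHS](galgE a) [LHS](linear_sum h'); apply: eq_bigr => x _.
exact: (linearZ_LR h').
Qed.

Lemma galg_elt1 : galg_elt 1%g = 1.
Proof. by []. Qed.

Lemma galg_eltM x y : galg_elt (x * y)%g = galg_elt x * galg_elt y.
Proof.
apply/ffunP=> z; rewrite !ffunE (bigD1 x) //= !ffunE eqxx mul1r big1.
  by rewrite addr0 -[in LHS](inj_eq (mulgI x^-1%g)) mulKg.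
by move=> w /negbTE nw; rewrite ffunE nw mul0r.
Qed.

Lemma galg_eltV x : galg_elt x^-1%g = (galg_elt x)^-1.
Proof.
have xV : galg_elt x^-1%g * galg_elt x = 1 by rewrite -galg_eltM mulVg.
have Vx : galg_elt x * galg_elt x^-1%g = 1 by rewrite -galg_eltM mulgV.
have Ux : galg_elt x \is a GRing.unit.
  by apply/unitrP; exists (galg_elt x^-1%g).
by apply: (mulIr Ux); rewrite mulVr.
Qed.

End GroupAlgebra.

Section Tensor.

Variables (k : fieldType) (gT1 gT2 : finGroupType).

(* k[G1] (x) k[G2] is realised as k[G1 * G2], with g (x) h the group element
   (g, h); galg_tens_universal and galg_tensM justify this identification. *)
Definition galg_tens (a : group_algebra k gT1) (b : group_algebra k gT2) :
    group_algebra k (gT1 * gT2)%type :=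
  [ffun p => a p.1 * b p.2].

Lemma galg_tens_elt x y :
  galg_tens (galg_elt k x) (galg_elt k y) = galg_elt k (x, y).
Proof.
by apply/ffunP=> -[u v]; rewrite !ffunE /= -natrM mulnb xpair_eqE.
Qed.

Lemma galg_tens_linearl b : linear (galg_tens^~ b).
Proof.
by move=> t a a'; apply/ffunP=> p; rewrite !ffunE mulrDl; congr (_ + _);
   rewrite [RHS]mulrA.
Qed.

Lemma galg_tens_linearr a : linear (galg_tens a).
Proof.
by move=> t b b'; apply/ffunP=> p; rewrite !ffunE mulrDr; congr (_ + _);
   rewrite [LHS]mulrCA.
Qed.

Lemma galg_tens1 : galg_tens 1 1 = 1.
Proof. exact: galg_tens_elt. Qed.

Lemma galg_tensM a a' b b' :
  galg_tens a b * galg_tens a' b' = galg_tens (a * a') (b * b').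
Proof.
apply/ffunP=> -[u v]; rewrite !ffunE /= mulr_suml.
under [RHS]eq_bigr do rewrite mulr_sumr.
rewrite pair_bigA /=; apply: eq_bigr => -[y z] _ /=.
by rewrite !ffunE /= mulrACA.
Qed.

Lemma galg_tens_universal (V : lmodType k)
    (f : group_algebra k gT1 -> group_algebra k gT2 -> V) :
    (forall b, linear (f^~ b)) -> (forall a, linear (f a)) ->
  exists h : {linear group_algebra k (gT1 * gT2)%type -> V},
    (forall a b, h (galg_tens a b) = f a b) /\
    (forall h' : {linear group_algebra k (gT1 * gT2)%type -> V},
       (forall a b, h' (galg_tens a b) = f a b) -> h' =1 h).
Proof.
move=> fl fr.
pose h0 (c : group_algebra k (gT1 * gT2)%type) :=
  \sum_p c p *: f (galg_elt k p.1) (galg_elt k p.2).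
have h0_lin : linear h0.
  move=> t c c'; rewrite /h0 scaler_sumr -big_split /=.
  by apply: eq_bigr => p _; rewrite !ffunE scalerDl scalerA.
pose hM := GRing.isLinear.Build _ _ _ _ h0 h0_lin.
pose h : {linear group_algebra k (gT1 * gT2)%type -> V} :=
  HB.pack h0 hM.
have hE (h' : {linear group_algebra k (gT1 * gT2)%type -> V}) :
  (forall a b, h' (galg_tens a b) = f a b) -> h' =1 h.
  move=> h'E c; rewrite [in LHS](galgE c) linear_sum /=; apply: eq_bigr => -[x y] _.
  by rewrite linearZ /= -galg_tens_elt h'E.
exists h; split=> // a b.
rewrite (galg_linearE (fl b)); under [RHS]eq_bigr => x _.
  rewrite (galg_linearE (fr _)) scaler_sumr.
  under eq_bigr => y _ do rewrite scalerA.
  over.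
by rewrite pair_bigA /=; apply: eq_bigr => -[x y] _; rewrite ffunE.
Qed.

End Tensor.

Section Coproduct.

Variables (k : fieldType) (gT : finGroupType).

Definition galg_coprod (a : group_algebra k gT) :
    group_algebra k (gT * gT)%type :=
  \sum_x a x *: galg_tens (galg_elt k x) (galg_elt k x).

Fact galg_coprod_linear : linear galg_coprod.
Proof.
move=> t a b; rewrite /galg_coprod scaler_sumr -big_split /=.
by apply: eq_bigr => x _; rewrite !ffunE scalerDl scalerA.
Qed.

HB.instance Definition _ := GRing.isLinear.Build k (group_algebra k gT)
  (group_algebra k (gT * gT)%type) _ galg_coprod galg_coprod_linear.

Lemma galg_coprod_elt x :
  galg_coprod (galg_elt k x) = galg_tens (galg_elt k x) (galg_elt k x).
Proof.
rewrite /galg_coprod (bigD1 x) //= ffunE eqxx scale1r big1 ?addr0 // => y.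
by move/negbTE=> ny; rewrite ffunE ny scale0r.
Qed.

Fact galg_coprod_monoid_morphism : monoid_morphism galg_coprod.
Proof.
split=> [|a b]; first by rewrite galg_coprod_elt galg_tens1.
rewrite (galgE a) mulr_suml !linear_sum /= mulr_suml; apply: eq_bigr => x _.
rewrite (galgE b) mulr_sumr !linear_sum /= mulr_sumr; apply: eq_bigr => y _.
rewrite -scalerAl -scalerAr !linearZ /= -galg_eltM !galg_coprod_elt.
by rewrite -scalerAl -scalerAr galg_tensM -galg_eltM.
Qed.

HB.instance Definition _ := GRing.isMonoidMorphism.Build (group_algebra k gT)
  (group_algebra k (gT * gT)%type) galg_coprod galg_coprod_monoid_morphism.

Definition galg_invariant (F : group_algebra k (gT * gT)%type) : Prop :=
  forall g : gT, GRing.comm F (galg_coprod (galg_elt k g)).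

End Coproduct.

Definition class_preserving (gT : finGroupType) (phi : {perm gT}) : Prop :=
  forall g : gT, phi g \in (g ^: [set: gT])%g.

(* Main.v *)
From HB Require Import structures.
Require Import Defs.
From mathcomp Require Import all_boot all_algebra all_fingroup all_field.
From mathcomp Require Import pgroup mxrepresentation.

(** Invariance of F is automatic once c induces phi: conjugating Delta(g) by F
    amounts to conjugating by c (x) c, which gives Delta(phi(g)), and then by
    Delta(c)^-1 = Delta(c^-1), which gives back Delta(g) because Delta is
    multiplicative. This is [galg_invariant_inner].

    So the content is that phi becomes inner in k[G]
    ([class_preserving_inner]). As k splits G and the characteristic does not
    divide |G|, the algebra k[G] is the product of the matrix algebras of the
    irreducible representations W_i. Precomposing W_i with phi gives an
    irreducible representation on which each central element of k[G] acts as it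
    does on W_i, since the center is spanned by the class sums and phi permutes
    each class. In particular the i-th central idempotent acts as the identity
    on it, so it is similar to W_i ([rsim_twist]), through an invertible matrix
    B_i. The element c with image B_i in every block
    ([galg_repr_irr_surj]) is a unit, and the relations phi(g) c = c g hold
    because they hold in every block ([galg_repr_irr_eq0]). *)

Set Implicit Arguments.
Unset Strict Implicit.
Unset Printing Implicit Defensive.

Import GroupScope GRing.Theory.
Local Open Scope ring_scope.
Local Open Scope group_ring_scope.

(** * Representations of G extended linearly to k[G] *)

Section LinearExtension.

Variables (k : fieldType) (gT : finGroupType).
Local Notation G := [set: gT]%G.

Definition galg_repr n (rG : mx_representation k G n)
  (a : group_algebra k gT) : 'M[k]_n := \sum_x a x *: rG x.

Section OneRepresentation.

Variables (n : nat) (rG : mx_representation k G n).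

Lemma galg_repr_linear : linear (galg_repr rG).
Proof.
move=> t a b; rewrite /galg_repr scaler_sumr -big_split /=.
by apply: eq_bigr => x _; rewrite !ffunE scalerDl scalerA.
Qed.

HB.instance Definition _ := GRing.isLinear.Build k (group_algebra k gT)
  'M[k]_n _ (galg_repr rG) galg_repr_linear.

Lemma galg_repr_elt x : galg_repr rG (galg_elt k x) = rG x.
Proof.
rewrite /galg_repr (bigD1 x) //= ffunE eqxx scale1r big1 ?addr0 // => y.
by move/negbTE=> ny; rewrite ffunE ny scale0r.
Qed.

Lemma galg_repr1 : galg_repr rG 1 = 1%:M.
Proof. by rewrite -galg_elt1 galg_repr_elt repr_mx1. Qed.

Lemma galg_reprM a b : galg_repr rG (a * b) = galg_repr rG a *m galg_repr rG b.
Proof.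
rewrite {1}(galgE a) mulr_suml linear_sum mulmx_suml; apply: eq_bigr => x _.
rewrite {1}(galgE b) mulr_sumr linear_sum mulmx_sumr; apply: eq_bigr => y _.
rewrite -scalerAl -scalerAr !linearZ /= -galg_eltM galg_repr_elt.
by rewrite -scalemxAl repr_mxM ?inE // !scalerA mulrC.
Qed.

(** The matrix model of the group ring is the image of the regular
    representation; passing through it gives access to the theory of Wedderburn
    components. *)
Lemma gring_op_regular a :
  gring_op rG (galg_repr (regular_repr k G) a) = galg_repr rG a.
Proof.
rewrite /galg_repr linear_sum; apply: eq_bigr => x _.
by rewrite linearZ /= gring_opG ?inE.
Qed.

End OneRepresentation.

Lemma galg_repr_regularP (A : 'M[k]_#|G|) :
  reflect (exists a, A = galg_repr (regular_repr k G) a) (A \in group_ring k G)%MS.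
Proof.
apply: (iffP envelop_mxP) => [[a ->] | [a ->]].
  exists [ffun x => a x]; rewrite /galg_repr; apply: eq_big => x; rewrite ?inE //.
  by rewrite ffunE.
by exists a; rewrite /galg_repr; apply: eq_big => x; rewrite ?inE.
Qed.

Lemma galg_repr_regular_inj : injective (galg_repr (regular_repr k G)).
Proof.
move=> a b eq_ab; apply/ffunP=> x.
have proj c : gring_proj x (galg_repr (regular_repr k G) c) = (c x)%:M.
  rewrite /galg_repr linear_sum (bigD1 x) //= linearZ /= gring_projE ?inE //.
  rewrite eqxx scalemx1 big1 ?addr0 // => y ne_yx.
  by rewrite linearZ /= gring_projE ?inE // eq_sym (negPf ne_yx) scaler0.
have := proj a; rewrite eq_ab proj => /matrixP/(_ 0 0).
by rewrite !mxE.
Qed.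

End LinearExtension.

(** * The block decomposition of k[G] *)

Section Wedderburn.

Variables (k : fieldType) (gT : finGroupType).
Local Notation G := [set: gT]%G.
Hypotheses (k'G : [pchar k]^'.-group G) (splitG : group_splitting_field k G).
Variable sG : irrType k G.

(** Decompose the regular image of a along the Wedderburn components. The
    representation W_i kills the components of index other than i and is
    faithful on the i-th one, so each summand vanishes. *)
Lemma galg_repr_irr_eq0 (a : group_algebra k gT) :
  (forall i : sG, galg_repr (irr_repr i) a = 0) -> a = 0.
Proof.
move=> a0; apply: (@galg_repr_regular_inj k gT); rewrite linear0.
have: (galg_repr (regular_repr k G) a \in group_ring k G)%MS.
  by apply/galg_repr_regularP; exists a.
rewrite -(Wedderburn_sum_pchar sG k'G) => /memmx_sumsP[A defA R_A].
rewrite defA big1 // => i _.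
have iK := irr_reprK_pchar k'G i; have irr_i := socle_irr i.
apply: (regular_op_inj_pchar (sG := sG) k'G irr_i).
- by rewrite inE iK R_A.
- by rewrite inE linear0 sub0mx.
rewrite linear0.
have := a0 i; rewrite -gring_op_regular defA linear_sum (bigD1 i) //=.
rewrite big1 ?addr0 // => j ne_ji.
exact: irr_repr'_op0_pchar ne_ji (R_A j).
Qed.

(** Over a splitting field the matrices of W_i span the full matrix algebra, so
    B_i lifts to the i-th Wedderburn component. The sum of these lifts works for
    all i at once, because W_i kills the lifts of the other B_j. *)
Lemma galg_repr_irr_surj (B : forall i : sG, 'M[k]_(irr_degree i)) :
  exists a, forall i : sG, galg_repr (irr_repr i) a = B i.
Proof.
have /fin_all_exists[A A_P] (i : sG) : exists A : 'M[k]_#|G|,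
  (A \in 'R_i)%MS /\ gring_op (irr_repr i) A = B i.
  have irr_i := socle_irr i; have /andP[_ full_i] := splitG irr_i.
  have: (B i \in enveloping_algebra_mx (irr_repr i))%MS by rewrite submx_full.
  rewrite -(irr_comp_envelop_pchar sG k'G irr_i) irr_reprK_pchar //.
  case/submxP=> u Bu; exists (vec_mx (u *m 'R_i)); split.
    by rewrite vec_mxK submxMl.
  by apply: (can_inj mxvecK); rewrite -mul_vec_lin vec_mxK -mulmxA.
have: (\sum_i A i \in group_ring k G)%MS.
  rewrite linear_sum summx_sub // => i _; rewrite -(Wedderburn_sum_pchar sG k'G).
  by apply: (sumsmx_sup i) => //; case: (A_P i).
case/galg_repr_regularP=> a Ea; exists a => i.
rewrite -gring_op_regular -Ea linear_sum (bigD1 i) //= big1 => [|j ne_ji].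
  by rewrite addr0; case: (A_P i).
by apply: irr_repr'_op0_pchar ne_ji _; case: (A_P j).
Qed.

End Wedderburn.

(** * Twisting a representation by a class-preserving automorphism *)

Section Twist.

Variables (k : fieldType) (gT : finGroupType) (phi : {perm gT}).
Local Notation G := [set: gT]%G.
Hypotheses (autphi : phi \in Aut [set: gT]) (classphi : class_preserving phi).

Lemma automM x y : phi (x * y)%g = (phi x * phi y)%g.
Proof. by rewrite -!(autmE autphi) morphM ?inE. Qed.

Section OneRepresentation.

Variables (n : nat) (rG : mx_representation k G n).

Lemma twist_mx_repr : mx_repr G (rG \o phi).
Proof.
split=> [|x y _ _] /=; last by rewrite automM repr_mxM ?inE.
have -> : phi 1%g = 1%g by rewrite -(autmE autphi) morph1.
exact: repr_mx1.
Qed.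

Definition twist_repr := MxRepresentation twist_mx_repr.

(** As phi is surjective, rG and its twist have the same submodules. *)
Lemma twist_mx_irr : mx_irreducible rG -> mx_irreducible twist_repr.
Proof.
case/mx_irrP=> n_gt0 irrG; apply/mx_irrP; split=> // U modU nzU.
apply: irrG => //; apply/mxmoduleP=> x Gx.
by have := mxmoduleP modU (phi^-1%g x) (in_setT _); rewrite /= permKV.
Qed.

(** The center is spanned by the class sums, and phi only permutes the terms of
    a class sum. This is where phi being class-preserving is used. *)
Lemma gring_op_twist_center A :
  (A \in 'Z(group_ring k G))%MS -> gring_op twist_repr A = gring_op rG A.
Proof.
rewrite -classg_base_center => /submxP[u Au].
rewrite -[A]mxvecK Au mulmx_sum_row !linear_sum; apply: eq_bigr => j _ /=.
rewrite !linearZ /=; congr (_ *: _); rewrite rowK mxvecK.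
have /imsetP[y _ ->] := enum_valP j.
rewrite !linear_sum /= [RHS](reindex_inj (@perm_inj _ phi)) /=.
apply: eq_big => [x | x _]; last by rewrite !gring_opG ?inE.
by rewrite class_sym -(class_eqP (classphi x)) class_sym.
Qed.

Variable sG : irrType k G.
Hypotheses (k'G : [pchar k]^'.-group G) (splitG : group_splitting_field k G).

(** The similarity type of an irreducible representation is read off from the
    central idempotent that does not act as zero, and each central idempotent
    acts in the same way on both sides. *)
Lemma rsim_twist : mx_irreducible rG -> mx_rsim rG twist_repr.
Proof.
move=> irrG; have irrT := twist_mx_irr irrG.
have eq_comp : irr_comp sG twist_repr = irr_comp sG rG.
  rewrite /irr_comp; congr (odflt _ _); apply: eq_pick => i.
  rewrite gring_op_twist_center //; rewrite (Wedderburn_center_pchar sG k'G splitG).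
  by apply: (eq_row_sub (enum_rank i)); rewrite rowK enum_rankK.
apply: mx_rsim_trans (rsim_irr_comp_pchar sG k'G irrG) _; rewrite -eq_comp.
exact/mx_rsim_sym/rsim_irr_comp_pchar.
Qed.

Lemma twist_intertwiner : mx_irreducible rG ->
  exists2 B, B \in unitmx & forall g, rG (phi g) *m B = B *m rG g.
Proof.
move/rsim_twist/mx_rsim_sym=> [B _ freeB homB].
by exists B => [|g]; rewrite -?row_free_unit ?homB ?inE.
Qed.

End OneRepresentation.

End Twist.

(** * Class-preserving automorphisms become inner in k[G] *)

Section ClassPreserving.

Variables (k : fieldType) (gT : finGroupType) (phi : {perm gT}).
Local Notation G := [set: gT]%G.

(** Solve phi(g) c = c g in each block, where the solution is an intertwiner
    between W_i and its twist, and assemble the solutions. The inverse of c is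
    the element whose blocks are the inverse intertwiners. *)
Lemma class_preserving_inner (sG : irrType k G) :
    [pchar k]^'.-group G -> group_splitting_field k G ->
    phi \in Aut [set: gT] -> class_preserving phi ->
  exists2 c : group_algebra k gT, c \is a GRing.unit
    & forall g, galg_elt k (phi g) * c = c * galg_elt k g.
Proof.
move=> k'G splitG autphi classphi.
have /fin_all_exists[B B_P] (i : sG) : exists B : 'M[k]_(irr_degree i),
  B \in unitmx /\ forall g, irr_repr i (phi g) *m B = B *m irr_repr i g.
  have [B] := twist_intertwiner autphi classphi sG k'G splitG (socle_irr i).
  by exists B.
have eq_irr (a b : group_algebra k gT) :
  (forall i : sG, galg_repr (irr_repr i) a = galg_repr (irr_repr i) b) -> a = b.
  move=> eq_ab; apply/eqP; rewrite -subr_eq0; apply/eqP.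
  by apply: (galg_repr_irr_eq0 k'G (sG := sG)) => i; rewrite linearB /= eq_ab subrr.
have [c c_P] := galg_repr_irr_surj k'G splitG B.
have [d d_P] := galg_repr_irr_surj k'G splitG (fun i => invmx (B i)).
exists c => [|g].
  apply/unitrP; exists d; split; apply: eq_irr => i;
    by rewrite galg_reprM galg_repr1 c_P d_P ?mulVmx ?mulmxV; case: (B_P i).
apply: eq_irr => i; rewrite !galg_reprM !galg_repr_elt c_P.
by case: (B_P i) => _ ->.
Qed.

(** After multiplication by Delta(c) on the left, both sides become
    phi(g) c (x) phi(g) c. *)
Lemma galg_invariant_inner (c : group_algebra k gT) : c \is a GRing.unit ->
    (forall g, galg_elt k (phi g) * c = c * galg_elt k g) ->
  galg_invariant ((galg_coprod c)^-1 * galg_tens c c).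
Proof.
move=> Uc cphi g; have UDc : galg_coprod c \is a GRing.unit by apply: rmorph_unit.
apply: (mulrI UDc); rewrite /GRing.comm -!mulrA mulVKr // !mulrA.
rewrite -rmorphM -cphi rmorphM /= mulrK //.
by rewrite !galg_coprod_elt !galg_tensM cphi.
Qed.

End ClassPreserving.

Theorem proposition5 (k : closedFieldType) (char_k : [pchar k] =i pred0)
    (gT : finGroupType) (phi : {perm gT}) (autphi : phi \in Aut [set: gT])
    (classphi : class_preserving phi) :
  exists c : group_algebra k gT,
    [/\ c \is a GRing.unit,
        forall g : gT, galg_elt k (phi g) = c * galg_elt k g * c^-1
      & galg_invariant ((galg_coprod c)^-1 * galg_tens c c)].
Proof.
have k'G : [pchar k]^'.-group [set: gT]%G.
  by apply: sub_pgroup (pgroup_pi _) => p _; apply/negP; rewrite char_k.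
have splitG : group_splitting_field k [set: gT]%G.
  exact: (@group_closure_closed_field k gT [set: gT]%G).
have [c Uc cphi] := class_preserving_inner (DecSocleType _) k'G splitG autphi classphi.
exists c; split=> // [g|]; first by rewrite -cphi mulrK.
exact: galg_invariant_inner cphi.
Qed.
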